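(* Let $G$ be a totally disconnected locally compact group and $\phi:G\to G$ a topological automorphism. Let $H$ be another totally disconnected locally compact group and $\xi:G\to H$ a topological isomorphism. Then $\xi(C(\phi,U))=C(\xi\phi\xi^{-1},\xi(U))$ for every $U\in\mathcal B(G)$, and $h_{top}(\phi)=h_{top}(\xi\phi\xi^{-1})$.
   Context: For a totally disconnected locally compact group $G$, $\mathcal B(G)$ denotes the family of all open compact subgroups of $G$. A topological isomorphism (automorphism) is a group isomorphism (automorphism) that is a homeomorphism. For a continuous endomorphism $\psi:G\to G$, $U\in\mathcal B(G)$ and an integer $n\ge 1$, put $$C_n(\psi,U)=U\cap\psi^{-1}(U)\cap\ldots\cap\psi^{-n+1}(U),\qquad C(\psi,U)=\bigcap_{n=0}^\infty\psi^{-n}(U).$$ The index $[U:C_n(\psi,U)]$ is finite. The topological entropy of $\psi$ with respect to $U$ is $H_{top}(\psi,U)=\lim_{n\to\infty}\frac{\log[U:C_n(\psi,U)]}{n}$ (the limit exists), and the topological entropy of $\psi$ is $h_{top}(\psi)=\sup\{H_{top}(\psi,U):U\in\mathcal B(G)\}\in[0,\infty]$. *)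

(* Defs.v *)
From HB Require Import structures.
From mathcomp Require Import all_boot all_order all_algebra.
From mathcomp Require Import finmap.
From mathcomp Require Import all_classical all_reals all_analysis.

Set Implicit Arguments.
Unset Strict Implicit.
Unset Printing Implicit Defensive.

Import Order.TTheory GRing.Theory Num.Theory.
Import numFieldNormedType.Exports.

Local Open Scope classical_set_scope.
Local Open Scope ring_scope.

HB.mixin Record Topological_isTopologicalGroup G
    of Topological G & Group G := {
  mulg_continuous : continuous (fun x : G * G => (x.1 * x.2)%g) ;
  invg_continuous : continuous (fun x : G => (x^-1)%g)
}.

#[short(type="topologicalGroupType")]
HB.structure Definition TopologicalGroup :=
  {G of Topological G & Group G & Topological_isTopologicalGroup G}.

(* No separation axiom is assumed separately: points are closed in a totally
   disconnected space, and a topological group with closed points is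
   Hausdorff. *)
Definition tdlc (G : topologicalGroupType) : Prop :=
  totally_disconnected [set: G] /\ locally_compact [set: G].

Definition open_compact_subgroups (G : topologicalGroupType) : set (set G) :=
  [set U | [/\ open U, compact U & group_closed [in U]]].
Arguments open_compact_subgroups : clear implicits.

Definition topological_isomorphism (G H : topologicalGroupType)
    (f : G -> H) : Prop :=
  {morph f : x y / (x * y)%g} /\
  exists g : H -> G,
    [/\ cancel f g, cancel g f, continuous f & continuous g].

Definition topological_automorphism (G : topologicalGroupType)
    (f : G -> G) : Prop := topological_isomorphism f.

Definition lcosets_in (G : groupType) (U K : set G) : set (set G) :=
  [set [set (x * y)%g | y in K] | x in U].

(* [U : K]; [fset_set] sends an infinite set to the empty one, so this is 0
   when the index is infinite. *)
Definition subgroup_index (G : groupType) (U K : set G) : nat :=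
  #|` fset_set (lcosets_in U K)|.

(* Meant for n >= 1; the intersection at n = 0 is the whole of G. *)
Definition cotrajectory_n (G : Type) (n : nat) (psi : G -> G) (U : set G) :
    set G :=
  \bigcap_(k in `I_n) (iter k psi @^-1` U).

Definition cotrajectory (G : Type) (psi : G -> G) (U : set G) : set G :=
  \bigcap_(k in [set: nat]) (iter k psi @^-1` U).

(* The term at n = 0 is a division by 0, hence 0; it does not affect the
   limit. *)
Definition Htop (R : realType) (G : topologicalGroupType) (psi : G -> G)
    (U : set G) : R :=
  limn (fun n : nat =>
    ln (subgroup_index U (cotrajectory_n n psi U))%:R / n%:R : R).

Definition htop (R : realType) (G : topologicalGroupType) (psi : G -> G) :
    \bar R :=
  ereal_sup [set (Htop R psi U)%:E | U in open_compact_subgroups G].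

(* Main.v *)
Require Import Defs.
From mathcomp Require Import all_boot all_order all_algebra.
From mathcomp Require Import finmap.
From mathcomp Require Import all_classical all_reals all_analysis.

(** Cotrajectories, indices and open compact subgroups are all built from the
    group law, the topology and the self-map, so a topological isomorphism
    transports each of them along with the self-map, conjugated by it.  Since
    the iterates of the conjugate are the conjugates of the iterates, the
    cotrajectories of [U] are carried onto those of the image of [U]
    ([image_bigcap_iter_conj]).  Left cosets go to left cosets bijectively, so
    indices agree ([subgroup_index_image]), and hence so do the entropies with
    respect to [U] and to its image ([Htop_conj]).  Finally [U] |-> image of
    [U] maps the open compact subgroups of one group onto those of the other
    ([open_compact_subgroups_image], used for the isomorphism and for its
    inverse), so both topological entropies are suprema of the same set. *)

Set Implicit Arguments.
Unset Strict Implicit.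
Unset Printing Implicit Defensive.

Local Open Scope classical_set_scope.

Lemma image_can_preimage (S T : Type) (f : S -> T) (g : T -> S) (A : set S) :
  cancel f g -> cancel g f -> f @` A = g @^-1` A.
Proof.
move=> fK gK; apply/seteqP; split=> [_ [x Ax <-]|y Agy].
  by rewrite /preimage /= fK.
by exists (g y).
Qed.

Lemma can_imageK (S T : Type) (f : S -> T) (g : T -> S) (A : set S) :
  cancel f g -> g @` (f @` A) = A.
Proof.
by move=> fK; rewrite image_comp -[RHS]image_id; apply: eq_imagel => x _ /=.
Qed.

Lemma iter_conj (S T : Type) (f : S -> T) (g : T -> S) (psi : S -> S)
    (k : nat) (y : T) :
  cancel f g -> cancel g f ->
  iter k (f \o psi \o g) y = f (iter k psi (g y)).
Proof.
by move=> fK gK; elim: k => [|k IHk]; rewrite /= ?gK// IHk fK.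
Qed.

(** The index set [D] is arbitrary so as to cover at once the full cotrajectory
    and its truncations. *)
Lemma image_bigcap_iter_conj (S T : Type) (f : S -> T) (g : T -> S)
    (psi : S -> S) (D : set nat) (U : set S) :
  cancel f g -> cancel g f ->
  f @` (\bigcap_(k in D) (iter k psi @^-1` U)) =
  \bigcap_(k in D) (iter k (f \o psi \o g) @^-1` (f @` U)).
Proof.
move=> fK gK; rewrite !(image_can_preimage _ fK gK) preimage_bigcap.
apply: eq_bigcapr => k _; apply/funext => y.
by rewrite /preimage /= iter_conj// fK.
Qed.

(** Infinite sets are included: injectivity makes the image infinite as well,
    and [fset_set] then gives the empty set on both sides. *)
Lemma card_fset_set_image (S T : choiceType) (f : S -> T) (g : T -> S)
    (A : set S) :
  cancel f g ->
  #|` fset_set (f @` A)| = #|` fset_set A|.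
Proof.
move=> fK; have [Afin|Ainf] := pselect (finite_set A).
  rewrite fset_set_image// card_imfset//; exact: can_inj fK.
rewrite /fset_set; case: pselect => [fAfin|_]; last by case: pselect.
suff : finite_set (g @` (f @` A)).
  by rewrite can_imageK.
exact: finite_image.
Qed.

Lemma lcosets_in_image (G H : groupType) (f : G -> H) (U K : set G) :
  {morph f : x y / (x * y)%g} ->
  lcosets_in (f @` U) (f @` K) = (fun C => f @` C) @` lcosets_in U K.
Proof.
move=> fM.
have fxK x : [set (f x * y)%g | y in f @` K] = f @` [set (x * y)%g | y in K].
  by rewrite !image_comp; apply: eq_imagel => y _ /=; rewrite fM.
rewrite /lcosets_in !image_comp.
by apply: eq_imagel => x _ /=; rewrite fxK.
Qed.

Lemma subgroup_index_image (G H : groupType) (f : G -> H) (g : H -> G)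
    (U K : set G) :
  {morph f : x y / (x * y)%g} -> cancel f g ->
  subgroup_index (f @` U) (f @` K) = subgroup_index U K.
Proof.
move=> fM fK; rewrite /subgroup_index lcosets_in_image//.
apply: (@card_fset_set_image _ _ _ (fun C => g @` C)) => C.
exact: can_imageK.
Qed.

Lemma Htop_conj (R : realType) (G H : topologicalGroupType) (f : G -> H)
    (g : H -> G) (psi : G -> G) (U : set G) :
  {morph f : x y / (x * y)%g} -> cancel f g -> cancel g f ->
  Htop R (f \o psi \o g) (f @` U) = Htop R psi U.
Proof.
move=> fM fK gK; rewrite /Htop /cotrajectory_n.
under eq_fun => n do
  rewrite -image_bigcap_iter_conj// (subgroup_index_image _ _ fM fK).
by [].
Qed.

Lemma group_closed_image (G H : groupType) (f : G -> H) (U : set G) :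
  {morph f : x y / (x * y)%g} ->
  group_closed [in U] -> group_closed [in f @` U].
Proof.
move=> fM [U1 UB].
have f1 : f 1%g = 1%g by apply: (@mulgI _ (f 1%g)); rewrite -fM !mulg1.
have fB x y : f (x / y)%g = (f x / f y)%g.
  by apply: (@mulIg _ (f y)); rewrite -fM !mulgVK.
split=> [|_ _ /set_mem[x Ux <-] /set_mem[y Uy <-]]; apply/mem_set.
  by exists 1%g => //; exact/set_mem.
by exists (x / y)%g => //; apply/set_mem/UB; exact/mem_set.
Qed.

Lemma open_compact_subgroups_image (G H : topologicalGroupType) (f : G -> H)
    (g : H -> G) (U : set G) :
  {morph f : x y / (x * y)%g} -> cancel f g -> cancel g f ->
  continuous f -> continuous g ->
  open_compact_subgroups G U -> open_compact_subgroups H (f @` U).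
Proof.
move=> fM fK gK cf cg [oU kU sU]; split.
- by rewrite (image_can_preimage _ fK gK); apply: open_comp => // y _; exact: cg.
- by apply: continuous_compact => //; exact: continuous_subspaceT.
- exact: group_closed_image.
Qed.

Lemma can_morphM (G H : groupType) (f : G -> H) (g : H -> G) :
  {morph f : x y / (x * y)%g} -> cancel f g -> cancel g f ->
  {morph g : x y / (x * y)%g}.
Proof. by move=> fM fK gK x y; rewrite -{1}(gK x) -{1}(gK y) -fM fK. Qed.

Theorem proposition4p3 (R : realType) (G H : topologicalGroupType)
    (hG : tdlc G) (hH : tdlc H)
    (phi : G -> G) (hphi : topological_automorphism phi)
    (xi : G -> H) (hxi : topological_isomorphism xi)
    (xi_inv : H -> G) (xiK : cancel xi xi_inv) (xi_invK : cancel xi_inv xi) :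
  (forall U : set G, open_compact_subgroups G U ->
     xi @` cotrajectory phi U =
       cotrajectory (xi \o phi \o xi_inv) (xi @` U)) /\
  htop R phi = htop R (xi \o phi \o xi_inv).
Proof.
split=> [U _|]; first exact: image_bigcap_iter_conj.
case: hxi => xiM [g [xig gxi cxi cg]].
have cxi_inv : continuous xi_inv.
  suff -> : xi_inv = g by [].
  by apply/funext => y; rewrite -{1}(gxi y) xiK.
have xi_invM := can_morphM xiM xiK xi_invK.
rewrite /htop; congr ereal_sup; apply/seteqP; split=> _ [U BU <-].
  exists (xi @` U); last by rewrite Htop_conj.
  exact: open_compact_subgroups_image xiM xiK xi_invK cxi cxi_inv BU.
exists (xi_inv @` U).
  exact: open_compact_subgroups_image xi_invM xi_invK xiK cxi_inv cxi BU.
rewrite -(Htop_conj R phi _ xiM xiK xi_invK).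
by rewrite can_imageK.
Qed.
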